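(* Let $G$ be a finite group, let $\omega\in Z^3_{\mathrm{gp}}(G,U(1))$ be a three-cocycle, and let $\tau\colon Z^3_{\mathrm{gp}}(G,U(1))\to Z^2(\Lambda\overline G,U(1))$ be the loop transgression map. Then the twisted Drinfeld double $D^\omega(G)$ of $G$ is isomorphic, as an associative algebra, to the twisted groupoid algebra ${}^{\tau(\omega)}\mathbb C(\Lambda\overline G)$.
   Context: Three-cocycles. $\omega\in Z^3_{\mathrm{gp}}(G,U(1))$ is a function $G^3\to U(1)$, normalized ($\omega=1$ if any argument is $e$), with $\omega(h,g,f)\,\omega(kh,g,f)^{-1}\,\omega(k,hg,f)\,\omega(k,h,gf)^{-1}\,\omega(k,h,g)=1$ for all $k,h,g,f\in G$. Twisted Drinfeld double. $D^\omega(G)$ (only the algebra structure is considered) is the complex algebra with basis $\{\langle\xleftarrow{g}x\rangle : g,x\in G\}$ and product $$\langle\xleftarrow{h}y\rangle\cdot\langle\xleftarrow{g}x\rangle:=\delta_{y,gxg^{-1}}\frac{\omega(h,g,x)\,\omega(hgx(hg)^{-1},h,g)}{\omega(h,gxg^{-1},g)}\langle\xleftarrow{hg}x\rangle.$$ Loop groupoid. $\overline G$ is the one-object groupoid with morphism group $G$. $\Lambda\overline G$ has objects the elements $x\in G$ and a morphism $g\colon x\to gxg^{-1}$ for each $x,g\in G$; composition is multiplication in $G$. $[h|g]x$ denotes the composable pair $hgx(hg)^{-1}\xleftarrow{h}gxg^{-1}\xleftarrow{g}x$. Loop transgression. In general, the loop transgression of an $n$-cocycle $\alpha$ is $\tau(\alpha)([g_{n-1}|\ldots|g_1]\gamma)=\prod_{i=0}^{n-1}\alpha([g_{n-1}|\ldots|g_{i+1}|(g_i\cdots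 g_1)\gamma(g_i\cdots g_1)^{-1}|g_i|\ldots|g_1])^{(-1)^{n-1-i}}$, where $\omega([k|h|g])=\omega(k,h,g)$; for a three-cocycle, $\tau(\omega)([h|g]x)=\frac{\omega(h,g,x)\,\omega(hgxg^{-1}h^{-1},h,g)}{\omega(h,gxg^{-1},g)}$. Twisted groupoid algebra. For a finite groupoid $\mathcal G$ and a two-cocycle $\theta\in Z^2(\mathcal G,U(1))$ (normalized $U(1)$-valued function on composable pairs with $\theta([g_2|g_1])\theta([g_3g_2|g_1])^{-1}\theta([g_3|g_2g_1])\theta([g_3|g_2])^{-1}=1$), ${}^\theta\mathbb C\mathcal G$ is the complex algebra with basis $\{\langle g\rangle\}$ indexed by morphisms and product $\langle g_2\rangle\langle g_1\rangle=\theta([g_2|g_1])\langle g_2\circ g_1\rangle$ if composable, $0$ otherwise. *)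

(* Defs.v *)
From HB Require Import structures.
From mathcomp Require Import all_boot all_order all_algebra all_fingroup.
From mathcomp Require Import ring.
From mathcomp Require Import complex.
From mathcomp Require Import reals.

Set Implicit Arguments.
Unset Strict Implicit.
Unset Printing Implicit Defensive.

Import Order.TTheory GRing.Theory Num.Theory.
Local Open Scope ring_scope.

(* The data of a finite-dimensional unital associative F-algebra with a basis
   in which the product of two basis vectors is a multiple of a basis vector,
     <p> <q> = mcoef p q <mprod p q>,
   and whose unit is the sum of the basis vectors indexed by munit.           *)
Record monomial_data (F : fieldType) := MonomialData {
  mindex :> finType;
  mcoef : mindex -> mindex -> F;
  mprod : mindex -> mindex -> mindex;
  munit : {set mindex};
  mcoefA : forall p q r,
    mcoef p q * mcoef (mprod p q) r = mcoef q r * mcoef p (mprod q r);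
  mprodA : forall p q r, mcoef p q * mcoef (mprod p q) r != 0 ->
    mprod (mprod p q) r = mprod p (mprod q r);
  munitl : forall p, exists2 u, u \in munit &
    [/\ mcoef u p = 1, mprod u p = p
      & forall v, v \in munit -> v != u -> mcoef v p = 0];
  munitr : forall p, exists2 u, u \in munit &
    [/\ mcoef p u = 1, mprod p u = p
      & forall v, v \in munit -> v != u -> mcoef p v = 0];
  munit_neq0 : munit != set0
}.

(* A vector is given by its coordinates in the basis. *)
Definition monomial_alg (F : fieldType) (B : monomial_data F) : Type :=
  {ffun B -> F^o}.

HB.instance Definition _ (F : fieldType) (B : monomial_data F) :=
  GRing.Lmodule.copy (monomial_alg B) {ffun B -> F^o}.

Section MonomialAlgebra.
Variables (F : fieldType) (B : monomial_data F).
Implicit Types (p q r : B) (a b c : monomial_alg B) (k : F).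

Definition mbasis p : monomial_alg B := [ffun q => (q == p)%:R].

Definition malg_mul a b : monomial_alg B :=
  \sum_p \sum_q (a p * b q * mcoef p q) *: mbasis (mprod p q).

Definition malg_one : monomial_alg B := \sum_(u in munit B) mbasis u.

Lemma malgE a : a = \sum_p a p *: mbasis p.
Proof.
apply/ffunP => q; rewrite sum_ffunE (bigD1 q) //= !ffunE eqxx /=.
rewrite big1 ?addr0; first by rewrite /GRing.scale /= mulr1.
move=> p /negPf npq; rewrite !ffunE eq_sym npq; exact: mulr0.
Qed.

Lemma mbasisE p q : mbasis p q = (q == p)%:R.
Proof. by rewrite ffunE. Qed.

Let malg_mulDl : left_distributive malg_mul +%R.
Proof.
move=> a b c; rewrite /malg_mul -big_split; apply: eq_bigr => p _ /=.
rewrite -big_split; apply: eq_bigr => q _ /=.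
by rewrite -scalerDl; congr (_ *: _); rewrite ffunE !mulrDl.
Qed.

Let malg_mulDr : right_distributive malg_mul +%R.
Proof.
move=> a b c; rewrite /malg_mul -big_split; apply: eq_bigr => p _ /=.
rewrite -big_split; apply: eq_bigr => q _ /=.
by rewrite -scalerDl; congr (_ *: _); rewrite ffunE mulrDr mulrDl.
Qed.

Let malg_scaleAl k a b : k *: malg_mul a b = malg_mul (k *: a) b.
Proof.
rewrite /malg_mul scaler_sumr; apply: eq_bigr => p _.
rewrite scaler_sumr; apply: eq_bigr => q _.
rewrite scalerA; congr (_ *: _); rewrite ffunE /GRing.scale /=; ring.
Qed.

Let malg_scaleAr k a b : k *: malg_mul a b = malg_mul a (k *: b).
Proof.
rewrite /malg_mul scaler_sumr; apply: eq_bigr => p _.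
rewrite scaler_sumr; apply: eq_bigr => q _.
rewrite scalerA; congr (_ *: _); rewrite ffunE /GRing.scale /=; ring.
Qed.

Let malg_mul_basis p q :
  malg_mul (mbasis p) (mbasis q) = mcoef p q *: mbasis (mprod p q).
Proof.
rewrite /malg_mul (bigD1 p) //= [X in _ + X]big1 ?addr0 => [|p' /negPf np].
  rewrite (bigD1 q) //= !mbasisE !eqxx !mul1r big1 ?addr0 // => q' /negPf nq.
  by rewrite !mbasisE nq mulr0 mul0r scale0r.
by apply: big1 => q' _; rewrite !mbasisE np !mul0r scale0r.
Qed.

Let malg_mul0l b : malg_mul 0 b = 0.
Proof. by have := malg_scaleAl 0 0 b; rewrite !scale0r => <-. Qed.

Let malg_mul0r a : malg_mul a 0 = 0.
Proof. by have := malg_scaleAr 0 a 0; rewrite !scale0r => <-. Qed.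

Let malg_mul_suml (I : Type) (s : seq I) (P : pred I)
    (G : I -> monomial_alg B) b :
  malg_mul (\sum_(i <- s | P i) G i) b = \sum_(i <- s | P i) malg_mul (G i) b.
Proof.
exact: (big_morph (malg_mul^~ b) (fun x y => malg_mulDl x y b) (malg_mul0l b)).
Qed.

Let malg_mul_sumr (I : Type) (s : seq I) (P : pred I)
    (G : I -> monomial_alg B) a :
  malg_mul a (\sum_(i <- s | P i) G i) = \sum_(i <- s | P i) malg_mul a (G i).
Proof. exact: (big_morph (malg_mul a) (malg_mulDr a) (malg_mul0r a)). Qed.

Let malg_mulA : associative malg_mul.
Proof.
have basA p q r : malg_mul (mbasis p) (malg_mul (mbasis q) (mbasis r))
    = malg_mul (malg_mul (mbasis p) (mbasis q)) (mbasis r).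
  rewrite !malg_mul_basis -malg_scaleAl -malg_scaleAr !malg_mul_basis !scalerA.
  have [c0|cN0] := eqVneq (mcoef p q * mcoef (mprod p q) r) 0.
    by rewrite -mcoefA c0 !scale0r.
  by rewrite -mcoefA (mprodA cN0).
pose linD (f : monomial_alg B -> monomial_alg B) :=
  (forall x y, f (x + y) = f x + f y) /\ (forall k x, f (k *: x) = k *: f x).
have ext f g : linD f -> linD g ->
    (forall p, f (mbasis p) = g (mbasis p)) -> f =1 g.
  move=> [fD fZ] [gD gZ] fg a.
  have f0 : f 0 = 0 by rewrite -(scale0r 0) fZ !scale0r.
  have g0 : g 0 = 0 by rewrite -(scale0r 0) gZ !scale0r.
  rewrite (malgE a) (big_morph f fD f0) (big_morph g gD g0).
  by apply: eq_bigr => p _; rewrite fZ gZ fg.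
have linl b f : linD f -> linD (fun x => malg_mul (f x) b).
  move=> [fD fZ]; split=> [x y|k x]; first by rewrite fD malg_mulDl.
  by rewrite fZ -malg_scaleAl.
have linr a f : linD f -> linD (fun x => malg_mul a (f x)).
  move=> [fD fZ]; split=> [x y|k x]; first by rewrite fD malg_mulDr.
  by rewrite fZ -malg_scaleAr.
have lin_id : linD id by [].
move=> a b c.
apply: (ext (fun x => malg_mul x (malg_mul b c))
            (fun x => malg_mul (malg_mul x b) c)); first exact: linl.
  by apply: (linl c (fun x => malg_mul x b)); apply: linl.
move=> p; apply: (ext (fun x => malg_mul (mbasis p) (malg_mul x c))
                      (fun x => malg_mul (malg_mul (mbasis p) x) c)).
- by apply: (linr _ (fun x => malg_mul x c)); apply: linl.
- by apply: (linl c (malg_mul (mbasis p))); apply: linr.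
move=> q; apply: (ext (fun x => malg_mul (mbasis p) (malg_mul (mbasis q) x))
                      (malg_mul (malg_mul (mbasis p) (mbasis q)))).
- by apply: (linr _ (malg_mul (mbasis q))); apply: linr.
- exact: linr.
exact: basA.
Qed.

Let malg_mul1l : left_id malg_one malg_mul.
Proof.
move=> a; rewrite {2}(malgE a) {1}(malgE a) malg_mul_sumr.
apply: eq_bigr => p _; rewrite -malg_scaleAr; congr (_ *: _).
have [u uU [c1 sp c0]] := munitl p.
rewrite /malg_one malg_mul_suml (bigD1 u) //= malg_mul_basis c1 sp scale1r.
rewrite big1 ?addr0 // => v /andP[vU vNu].
by rewrite malg_mul_basis c0 // scale0r.
Qed.

Let malg_mul1r : right_id malg_one malg_mul.
Proof.
move=> a; rewrite {2}(malgE a) {1}(malgE a) malg_mul_suml.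
apply: eq_bigr => p _; rewrite -malg_scaleAl; congr (_ *: _).
have [u uU [c1 sp c0]] := munitr p.
rewrite /malg_one malg_mul_sumr (bigD1 u) //= malg_mul_basis c1 sp scale1r.
rewrite big1 ?addr0 // => v /andP[vU vNu].
by rewrite malg_mul_basis c0 // scale0r.
Qed.

Let malg_one_neq0 : malg_one != 0.
Proof.
have /set0Pn[u uU] := munit_neq0 B.
apply/eqP => /ffunP /(_ u); rewrite sum_ffunE (bigD1 u) //= mbasisE eqxx ffunE.
rewrite big1 ?addr0; first by move/eqP; rewrite oner_eq0.
by move=> v /andP[_ /negPf vNu]; rewrite mbasisE eq_sym vNu.
Qed.

HB.instance Definition _ :=
  GRing.Zmodule_isNzRing.Build (monomial_alg B) malg_mulA malg_mul1l malg_mul1r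
    malg_mulDl malg_mulDr malg_one_neq0.
HB.instance Definition _ :=
  GRing.Lmodule_isLalgebra.Build F (monomial_alg B) malg_scaleAl.
HB.instance Definition _ :=
  GRing.Lalgebra_isAlgebra.Build F (monomial_alg B) malg_scaleAr.

Lemma mbasisM p q : mbasis p * mbasis q = mcoef p q *: mbasis (mprod p q).
Proof. exact: malg_mul_basis. Qed.

Lemma malg_mulE a b :
  a * b = \sum_p \sum_q (a p * b q * mcoef p q) *: mbasis (mprod p q).
Proof. by []. Qed.

Lemma malg_1E : 1 = malg_one.
Proof. by []. Qed.

End MonomialAlgebra.

(* gcomp g2 g1 is the composite of g1 followed by g2; its value is irrelevant
   unless (g2, g1) is composable. Groupoids are required to be nonempty because
   MathComp algebras are nontrivial.                                          *)
Record finGroupoid := FinGroupoid {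
  gobj : finType;
  gmor : finType;
  gsrc : gmor -> gobj;
  gtgt : gmor -> gobj;
  gid : gobj -> gmor;
  ginv : gmor -> gmor;
  gcomp : gmor -> gmor -> gmor;
  gsrc_id : forall x, gsrc (gid x) = x;
  gtgt_id : forall x, gtgt (gid x) = x;
  gsrc_comp : forall g2 g1, gsrc g2 = gtgt g1 -> gsrc (gcomp g2 g1) = gsrc g1;
  gtgt_comp : forall g2 g1, gsrc g2 = gtgt g1 -> gtgt (gcomp g2 g1) = gtgt g2;
  gcompA : forall g3 g2 g1, gsrc g3 = gtgt g2 -> gsrc g2 = gtgt g1 ->
    gcomp g3 (gcomp g2 g1) = gcomp (gcomp g3 g2) g1;
  gcomp1m : forall g, gcomp (gid (gtgt g)) g = g;
  gcompm1 : forall g, gcomp g (gid (gsrc g)) = g;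
  gsrc_inv : forall g, gsrc (ginv g) = gtgt g;
  gtgt_inv : forall g, gtgt (ginv g) = gsrc g;
  gcompVm : forall g, gcomp (ginv g) g = gid (gsrc g);
  gcompmV : forall g, gcomp g (ginv g) = gid (gtgt g);
  gobj_gt0 : (0 < #|gobj|)%N
}.

Section TwistedGroupoidAlgebra.
Variables (R : realType) (Gd : finGroupoid).

(* Only the values of c2 on composable pairs are meaningful. *)
Record cocycle2 := Cocycle2 {
  c2 :> gmor Gd -> gmor Gd -> R[i];
  c2_U1 : forall g2 g1, gsrc g2 = gtgt g1 -> `|c2 g2 g1| = 1;
  c2_1m : forall g, c2 (gid (gtgt g)) g = 1;
  c2_m1 : forall g, c2 g (gid (gsrc g)) = 1;
  c2_cocycle : forall g3 g2 g1, gsrc g3 = gtgt g2 -> gsrc g2 = gtgt g1 ->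
    c2 g2 g1 * (c2 (gcomp g3 g2) g1)^-1 * c2 g3 (gcomp g2 g1)
      * (c2 g3 g2)^-1 = 1
}.

Variable theta : cocycle2.

Definition tga_coef (g2 g1 : gmor Gd) : R[i] :=
  if gsrc g2 == gtgt g1 then theta g2 g1 else 0.

Lemma c2_neq0 g2 g1 : gsrc g2 = gtgt g1 -> theta g2 g1 != 0.
Proof. by move=> e; rewrite -normr_eq0 c2_U1 // oner_eq0. Qed.

Lemma tga_coefA g3 g2 g1 :
  tga_coef g3 g2 * tga_coef (gcomp g3 g2) g1
    = tga_coef g2 g1 * tga_coef g3 (gcomp g2 g1).
Proof.
rewrite /tga_coef.
have [e32|n32] := eqVneq (gsrc g3) (gtgt g2); last first.
  have [e21|_] := eqVneq (gsrc g2) (gtgt g1); last by rewrite !mul0r.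
  by rewrite gtgt_comp // (negPf n32) mul0r mulr0.
have [e21|n21] := eqVneq (gsrc g2) (gtgt g1); last first.
  by rewrite gsrc_comp // (negPf n21) mul0r mulr0.
rewrite gsrc_comp // gtgt_comp // e21 e32 !eqxx.
have := c2_cocycle theta e32 e21.
have n1 : theta g3 g2 != 0 by apply: c2_neq0.
have n2 : theta (gcomp g3 g2) g1 != 0 by apply: c2_neq0; rewrite gsrc_comp.
move=> /(congr1 (fun z => z * (theta g3 g2 * theta (gcomp g3 g2) g1))).
rewrite mul1r => <-; field; exact/andP.
Qed.

Lemma tga_prodA g3 g2 g1 :
  tga_coef g3 g2 * tga_coef (gcomp g3 g2) g1 != 0 ->
  gcomp (gcomp g3 g2) g1 = gcomp g3 (gcomp g2 g1).
Proof.
rewrite /tga_coef; have [e32|_] := eqVneq (gsrc g3) (gtgt g2); last first.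
  by rewrite mul0r eqxx.
rewrite gsrc_comp //; have [e21 _|_] := eqVneq (gsrc g2) (gtgt g1); last first.
  by rewrite mulr0 eqxx.
by rewrite gcompA.
Qed.

Definition tga_unit : {set gmor Gd} := [set gid x | x : gobj Gd].

Lemma tga_unitl g : exists2 u, u \in tga_unit &
  [/\ tga_coef u g = 1, gcomp u g = g
    & forall v, v \in tga_unit -> v != u -> tga_coef v g = 0].
Proof.
exists (gid (gtgt g)); first exact: imset_f.
split; [by rewrite /tga_coef gsrc_id eqxx c2_1m | exact: gcomp1m |].
move=> _ /imsetP[x _ ->]; rewrite /tga_coef gsrc_id.
by case: (eqVneq x (gtgt g)) => // ->; rewrite eqxx.
Qed.

Lemma tga_unitr g : exists2 u, u \in tga_unit &
  [/\ tga_coef g u = 1, gcomp g u = g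
    & forall v, v \in tga_unit -> v != u -> tga_coef g v = 0].
Proof.
exists (gid (gsrc g)); first exact: imset_f.
split; [by rewrite /tga_coef gtgt_id eqxx c2_m1 | exact: gcompm1 |].
move=> _ /imsetP[x _ ->]; rewrite /tga_coef gtgt_id eq_sym.
by case: (eqVneq x (gsrc g)) => // ->; rewrite eqxx.
Qed.

Lemma tga_unit_neq0 : tga_unit != set0.
Proof.
by have /card_gt0P[x _] := gobj_gt0 Gd; apply/set0Pn; exists (gid x);
  apply: imset_f.
Qed.

Definition twisted_groupoid_data : monomial_data R[i] :=
  MonomialData tga_coefA tga_prodA tga_unitl tga_unitr tga_unit_neq0.

Definition twisted_groupoid_algebra : algType R[i] :=
  monomial_alg twisted_groupoid_data.

End TwistedGroupoidAlgebra.

Section LoopGroupoid.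
Variable gT : finGroupType.
Local Open Scope group_scope.

(* The pair (g, x) is the morphism g : x -> g x g^-1. *)
Let lmor : finType := (gT * gT)%type.
Let lsrc (m : lmor) : gT := m.2.
Let ltgt (m : lmor) : gT := m.1 * m.2 * m.1^-1.
Let lid (x : gT) : lmor := (1, x).
Let linv (m : lmor) : lmor := (m.1^-1, m.1 * m.2 * m.1^-1).
Let lcomp (m2 m1 : lmor) : lmor := (m2.1 * m1.1, m1.2).

Fact loop_tgt_id x : ltgt (lid x) = x.
Proof. by rewrite /ltgt /= mul1g invg1 mulg1. Qed.

Fact loop_tgt_comp m2 m1 : lsrc m2 = ltgt m1 -> ltgt (lcomp m2 m1) = ltgt m2.
Proof. by rewrite /lsrc /ltgt /= => ->; rewrite invMg !mulgA. Qed.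

Fact loop_compA m3 m2 m1 : lsrc m3 = ltgt m2 -> lsrc m2 = ltgt m1 ->
  lcomp m3 (lcomp m2 m1) = lcomp (lcomp m3 m2) m1.
Proof. by rewrite /lcomp /= mulgA. Qed.

Fact loop_comp1m m : lcomp (lid (ltgt m)) m = m.
Proof. by case: m => g x; rewrite /lcomp /= mul1g. Qed.

Fact loop_compm1 m : lcomp m (lid (lsrc m)) = m.
Proof. by case: m => g x; rewrite /lcomp /= mulg1. Qed.

Fact loop_tgt_inv m : ltgt (linv m) = lsrc m.
Proof. by rewrite /ltgt /lsrc /= invgK !mulgA mulVg mul1g mulgKV. Qed.

Fact loop_compVm m : lcomp (linv m) m = lid (lsrc m).
Proof. by rewrite /lcomp /= mulVg. Qed.

Fact loop_compmV m : lcomp m (linv m) = lid (ltgt m).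
Proof. by rewrite /lcomp /= mulgV. Qed.

Fact loop_obj_gt0 : (0 < #|gT|)%N.
Proof. by apply/card_gt0P; exists 1. Qed.

Definition loop_groupoid : finGroupoid :=
  @FinGroupoid gT lmor lsrc ltgt lid linv lcomp (fun _ => erefl) loop_tgt_id
    (fun _ _ _ => erefl) loop_tgt_comp loop_compA loop_comp1m loop_compm1
    (fun _ => erefl) loop_tgt_inv loop_compVm loop_compmV loop_obj_gt0.

End LoopGroupoid.

Fact transgression3_field (F : fieldType)
    (a1 a2 a3 a4 a5 b1 b2 b3 b4 c1 c2 c4 c5 d2 d3 d5 : F) :
  a1 != 0 -> a2 != 0 -> a3 != 0 -> a4 != 0 -> a5 != 0 ->
  b1 != 0 -> b2 != 0 -> b3 != 0 -> b4 != 0 ->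
  c1 != 0 -> c2 != 0 -> c4 != 0 -> c5 != 0 ->
  d2 != 0 -> d3 != 0 -> d5 != 0 ->
  a1 * a2 * a3 = a4 * a5 -> b1 * b2 * b3 = b4 * a5 ->
  c1 * b2 * c2 = c4 * c5 -> a3 * d2 * d3 = c4 * d5 ->
  (b3 * d3 / c2) * (a4 * d2 / b4) = (a1 * c1 / b1) * (a2 * d5 / c5).
Proof.
move=> n1 n2 n3 n4 n5 m1 m2 m3 m4 p1 p2 p4 p5 q2 q3 q5 ea eb ec ed.
have -> : a4 = a1 * a2 * a3 / a5 by rewrite ea mulfK.
have -> : b4 = b1 * b2 * b3 / a5 by rewrite eb mulfK.
have -> : c5 = c1 * b2 * c2 / c4 by rewrite ec mulrC mulKf.
have -> : d5 = a3 * d2 * d3 / c4 by rewrite ed mulrC mulKf.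
by field; rewrite ?n1 ?n2 ?n3 ?n5 ?m1 ?m2 ?m3 ?p1 ?p2 ?p4.
Qed.

Section ThreeCocycles.
Variables (R : realType) (gT : finGroupType).

Record cocycle3 := Cocycle3 {
  c3 :> gT -> gT -> gT -> R[i];
  c3_U1 : forall h g f, `|c3 h g f| = 1;
  c3_1mm : forall g f, c3 1%g g f = 1;
  c3_m1m : forall h f, c3 h 1%g f = 1;
  c3_mm1 : forall h g, c3 h g 1%g = 1;
  c3_cocycle : forall k h g f : gT,
    c3 h g f * (c3 (k * h)%g g f)^-1 * c3 k (h * g)%g f
      * (c3 k h (g * f)%g)^-1 * c3 k h g = 1
}.

(* A group n-cochain alpha is evaluated on bar chains [g_n|...|g_1], which are
   lists of length n; gs is the list [g_(n-1)|...|g_1], so that n - 1 = size gs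
   and drop (n - 1 - i) gs is [g_i|...|g_1].                                  *)
Definition loop_transgression (alpha : seq gT -> R[i]) (gs : seq gT) (x : gT)
    : R[i] :=
  \prod_(i < (size gs).+1)
    let l := take (size gs - i) gs in
    let r := drop (size gs - i) gs in
    let p := (\prod_(g <- r) g)%g in
    alpha (l ++ (p * x * p^-1)%g :: r) ^ ((-1) ^+ (size gs - i) : int).

(* omega as a function on bar chains, with a dummy value off length 3. *)
Definition bar3 (omega : cocycle3) (s : seq gT) : R[i] :=
  if s is [:: k; h; g] then omega k h g else 1.

Variable omega : cocycle3.

Lemma loop_transgression3E h g x :
  loop_transgression (bar3 omega) [:: h; g] x =
    omega h g x * omega (h * g * x * (h * g)^-1)%g h g
      / omega h (g * x * g^-1)%g g.
Proof.
rewrite /loop_transgression !big_ord_recr big_ord0 /= !mul1r.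
rewrite !big_cons !big_nil !mulg1 mul1g invg1 mulg1.
by rewrite subn0 subn1 subnn expr0 expr1 sqrrN expr1n !expr1z exprN1 mulrAC.
Qed.

Lemma c3_neq0 h g f : omega h g f != 0.
Proof. by rewrite -normr_eq0 c3_U1 oner_eq0. Qed.

Lemma c3_eq k h g f :
  omega h g f * omega k (h * g)%g f * omega k h g
    = omega (k * h)%g g f * omega k h (g * f)%g.
Proof.
have n1 := c3_neq0 (k * h)%g g f; have n2 := c3_neq0 k h (g * f)%g.
rewrite -[RHS]mul1r -(c3_cocycle omega k h g f); field; exact/andP.
Qed.

(* [k|h|g]x, with the conjugates written out. *)
Lemma transgression3_eq k h g x :
  let t h g x := omega h g x * omega (h * g * x * (h * g)^-1)%g h g
      / omega h (g * x * g^-1)%g g in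
  t k h (g * x * g^-1)%g * t (k * h)%g g x = t h g x * t k (h * g)%g x.
Proof.
move=> /=.
set x1 := (g * x * g^-1)%g.
have -> : (h * g * x * (h * g)^-1)%g = (h * x1 * h^-1)%g.
  by rewrite invMg !mulgA.
set x2 := (h * x1 * h^-1)%g.
have -> : (k * h * x1 * (k * h)^-1)%g = (k * x2 * k^-1)%g.
  by rewrite invMg !mulgA.
have -> : (k * h * g * x * (k * h * g)^-1)%g = (k * x2 * k^-1)%g.
  by rewrite !invMg !mulgA.
have -> : (k * (h * g) * x * (k * (h * g))^-1)%g = (k * x2 * k^-1)%g.
  by rewrite !invMg !mulgA.
set x3 := (k * x2 * k^-1)%g.
have e1 := c3_eq k h g x.
have e2 := c3_eq k h x1 g.
have e3 := c3_eq k x2 h g.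
have e4 := c3_eq x3 k h g.
have gx : (x1 * g = g * x)%g by rewrite mulgKV.
have hx : (x2 * h = h * x1)%g by rewrite mulgKV.
have kx : (x3 * k = k * x2)%g by rewrite mulgKV.
rewrite gx in e2; rewrite hx in e3; rewrite kx in e4.
by apply: transgression3_field e1 e2 e3 e4; apply: c3_neq0.
Qed.

Lemma transgression3_1m g x : loop_transgression (bar3 omega) [:: 1%g; g] x = 1.
Proof.
rewrite loop_transgression3E mul1g c3_1mm mul1r c3_m1m c3_1mm; exact: divr1.
Qed.

Lemma transgression3_m1 g x : loop_transgression (bar3 omega) [:: g; 1%g] x = 1.
Proof.
rewrite loop_transgression3E c3_m1m c3_mm1 mul1r c3_mm1; exact: divr1.
Qed.

(* The morphism pair (m2, m1) is [h|g]x with h = m2.1, g = m1.1, x = m1.2.    *)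
Definition transgression_fun (m2 m1 : gmor (loop_groupoid gT)) : R[i] :=
  loop_transgression (bar3 omega) [:: m2.1; m1.1] m1.2.

Fact transgression_U1 m2 m1 :
  gsrc m2 = gtgt m1 -> `|transgression_fun m2 m1| = 1.
Proof.
move=> _; rewrite /transgression_fun loop_transgression3E.
by rewrite normrM normfV normrM !c3_U1 mulr1 divr1.
Qed.

Fact transgression_1m m : transgression_fun (gid (gtgt m)) m = 1.
Proof. exact: transgression3_1m. Qed.

Fact transgression_m1 m : transgression_fun m (gid (gsrc m)) = 1.
Proof. exact: transgression3_m1. Qed.

Fact transgression_cocycle (m3 m2 m1 : gmor (loop_groupoid gT)) :
  gsrc m3 = gtgt m2 -> gsrc m2 = gtgt m1 ->
  transgression_fun m2 m1 * (transgression_fun (gcomp m3 m2) m1)^-1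
    * transgression_fun m3 (gcomp m2 m1) * (transgression_fun m3 m2)^-1 = 1.
Proof.
case: m3 m2 m1 => [k z] [h y] [g x]; rewrite /gsrc /gtgt /= => _ ->.
have aux (a b c d : R[i]) : b != 0 -> d != 0 -> d * b = a * c ->
    a * b^-1 * c * d^-1 = 1.
  move=> b0 d0 e; have -> : a * b^-1 * c * d^-1 = a * c / (d * b).
    by field; apply/andP.
  by rewrite -e divff // mulf_neq0.
rewrite /transgression_fun /= !loop_transgression3E.
apply: aux; rewrite ?(mulf_neq0, invr_neq0, c3_neq0) //.
exact: transgression3_eq.
Qed.

(* tau(omega) *)
Definition transgression : cocycle2 R (loop_groupoid gT) :=
  Cocycle2 transgression_U1 transgression_1m transgression_m1
    transgression_cocycle.

End ThreeCocycles.

Section TwistedDrinfeldDouble.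
Variables (R : realType) (gT : finGroupType) (omega : cocycle3 R gT).

(* The pair (g, x) indexes the basis vector <<-g- x>. *)
Let dindex : finType := (gT * gT)%type.

Definition dd_coef (q p : dindex) : R[i] :=
  let: (h, y) := q in let: (g, x) := p in
  (y == g * x * g^-1)%g%:R *
  (omega h g x * omega (h * g * x * (h * g)^-1)%g h g
     / omega h (g * x * g^-1)%g g).

Definition dd_prod (q p : dindex) : dindex :=
  let: (h, y) := q in let: (g, x) := p in ((h * g)%g, x).

Definition dd_unit : {set dindex} := [set (1%g, x) | x : gT].

Fact dd_coefA r q p :
  dd_coef r q * dd_coef (dd_prod r q) p = dd_coef q p * dd_coef r (dd_prod q p).
Proof.
case: r q p => [k z] [h y] [g x]; rewrite /dd_coef /dd_prod.
have [->|_] := eqVneq y; last by rewrite !mul0r mulr0.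
rewrite !invMg !mulgA; case: eqP => _; last by rewrite !mul0r mulr0.
by rewrite !mul1r; have := transgression3_eq omega k h g x;
  rewrite /= !invMg !mulgA.
Qed.

Fact dd_prodA r q p : dd_coef r q * dd_coef (dd_prod r q) p != 0 ->
  dd_prod (dd_prod r q) p = dd_prod r (dd_prod q p).
Proof. by case: r q p => [k z] [h y] [g x] _; rewrite /dd_prod mulgA. Qed.

Fact dd_unitl p : exists2 u, u \in dd_unit &
  [/\ dd_coef u p = 1, dd_prod u p = p
    & forall v, v \in dd_unit -> v != u -> dd_coef v p = 0].
Proof.
case: p => [g x]; exists (1%g, (g * x * g^-1)%g); first exact: imset_f.
split.
- by rewrite /dd_coef eqxx mul1r -loop_transgression3E transgression3_1m.
- by rewrite /dd_prod mul1g.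
move=> _ /imsetP[y _ ->]; rewrite /dd_coef.
by have [->|_] := eqVneq y (g * x * g^-1)%g; rewrite ?eqxx // mul0r.
Qed.

Fact dd_unitr p : exists2 u, u \in dd_unit &
  [/\ dd_coef p u = 1, dd_prod p u = p
    & forall v, v \in dd_unit -> v != u -> dd_coef p v = 0].
Proof.
case: p => [g x]; exists (1%g, x); first exact: imset_f.
split.
- rewrite /dd_coef -loop_transgression3E transgression3_m1.
  by rewrite mul1g invg1 mulg1 eqxx mulr1.
- by rewrite /dd_prod mulg1.
move=> _ /imsetP[y _ ->]; rewrite /dd_coef mul1g invg1 mulg1.
by have [->|_] := eqVneq x y; rewrite ?eqxx // mul0r.
Qed.

Fact dd_unit_neq0 : dd_unit != set0.
Proof. by apply/set0Pn; exists (1%g, 1%g); apply: imset_f. Qed.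

Definition drinfeld_double_data : monomial_data R[i] :=
  MonomialData dd_coefA dd_prodA dd_unitl dd_unitr dd_unit_neq0.

Definition twisted_drinfeld_double : algType R[i] :=
  monomial_alg drinfeld_double_data.

End TwistedDrinfeldDouble.

(* Main.v *)
(* The morphism g : x -> g x g^-1 of the loop groupoid and the basis vector
   <<-g- x> are both indexed by (g, x). Under this identification the structure
   constants agree, because the transgression formula for tau(omega) is the
   coefficient in the product of the double; so the bases correspond under an
   algebra isomorphism. *)
Require Import Defs.
From HB Require Import structures.
From mathcomp Require Import all_boot all_order all_algebra all_fingroup.
From mathcomp Require Import complex.
From mathcomp Require Import reals.

Import GRing.Theory.
Local Open Scope ring_scope.

Section Relabel.
Variables (F : fieldType) (B B' : monomial_data F).
Variables (phi : B -> B') (psi : B' -> B).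
Hypotheses (phiK : cancel phi psi) (psiK : cancel psi phi).
Hypothesis phi_coef : forall p q, mcoef (phi p) (phi q) = mcoef p q.
(** Where the coefficient vanishes, the value of [mprod] is a mere default. *)
Hypothesis phi_prod : forall p q, mcoef p q != 0 ->
  phi (mprod p q) = mprod (phi p) (phi q).

(** Vectors are coordinate functions, so moving the basis along [phi] means precomposing with its
    inverse. *)
Definition relabel (a : monomial_alg B) : monomial_alg B' :=
  [ffun q => a (psi q)].

Fact relabel_linear : linear relabel.
Proof. by move=> k a b; apply/ffunP => q; rewrite !ffunE. Qed.

HB.instance Definition _ :=
  GRing.isLinear.Build F (monomial_alg B) (monomial_alg B') _ relabel
    relabel_linear.

Lemma relabel_basis p : relabel (mbasis p) = mbasis (phi p).
Proof. by apply/ffunP => q; rewrite !ffunE (can2_eq psiK phiK). Qed.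

Lemma relabel_bij : bijective relabel.
Proof.
exists (fun b : monomial_alg B' => [ffun p => b (phi p)] : monomial_alg B) => a;
  by apply/ffunP => p; rewrite !ffunE ?phiK ?psiK.
Qed.

(** Reindexing both sums of the target product along [phi] matches the two expansions term by
    term. *)
Lemma relabelM : {morph relabel : a b / a * b}.
Proof.
move=> a b; rewrite !malg_mulE linear_sum /=.
rewrite [RHS](reindex phi) /=; last by exists psi => ? _.
apply: eq_bigr => p _; rewrite linear_sum /=.
rewrite [RHS](reindex phi) /=; last by exists psi => ? _.
apply: eq_bigr => q _; rewrite linearZ /= relabel_basis !ffunE !phiK phi_coef.
have [->|pq] := eqVneq (mcoef p q) 0; first by rewrite mulr0 !scale0r.
by rewrite phi_prod.
Qed.

Fact relabel_monoid_morphism : monoid_morphism relabel.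
Proof.
split; last exact: relabelM.
(* Surjectivity gives the unit: [g 1] is a preimage of [1], and multiplying it by [1] on the left
   forces [relabel 1 = 1]. *)
have [g _ gK] := relabel_bij.
by have := relabelM 1 (g 1); rewrite mul1r gK mulr1.
Qed.

HB.instance Definition _ :=
  GRing.isMonoidMorphism.Build (monomial_alg B) (monomial_alg B') relabel
    relabel_monoid_morphism.

Lemma monomial_alg_iso :
  exists f : {lrmorphism monomial_alg B -> monomial_alg B'}, bijective f.
Proof. by exists relabel; exact: relabel_bij. Qed.

End Relabel.

Lemma tga_coef_transgression (R : realType) (gT : finGroupType) (omega : cocycle3 R gT)
    (q p : drinfeld_double_data omega) :
  tga_coef (transgression omega) q p = dd_coef omega q p.
Proof.
case: q p => [h y] [g x].
rewrite /tga_coef /dd_coef /= /transgression_fun loop_transgression3E /=.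
(* The Kronecker delta of the double is the composability test of the groupoid. *)
by case: eqP => _; rewrite ?mul1r ?mul0r.
Qed.

Theorem theorem17 (R : realType) (gT : finGroupType) (omega : cocycle3 R gT) :
  exists f : {lrmorphism twisted_drinfeld_double omega ->
                         twisted_groupoid_algebra (transgression omega)},
    bijective f.
Proof.
apply: (@monomial_alg_iso _ (drinfeld_double_data omega)
  (twisted_groupoid_data (transgression omega)) id id) => //.
- exact: tga_coef_transgression.
(* [dd_prod] matches on pairs, [gcomp] uses projections; they agree by computation on explicit
   pairs. *)
- by move=> [h y] [g x].
Qed.
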